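(* There exists a positive absolute constant $K$ such that for all $0<q<1$, all $f\in C^{2}[0,1]$, all integers $n\ge1$ and all $x\in[0,1]$, $$\left|\frac{[n]}{q^{n}}\bigl(R_{n,q}(f,x)-R_{\infty,q}(f,x)\bigr)-\frac{f''(x)}{2}\,x\bigl(1-v(q,x)\bigr)\right|\le K\,x\bigl(1-v(q,x)\bigr)\,\omega\!\left(f'',[n]^{-1/2}\right).$$
   Context: For $q>0$ and an integer $n\ge 0$: $[n]=1+q+\dots+q^{n-1}$, $[0]=0$; $[n]!=[1][2]\cdots[n]$, $[0]!=1$; for $0\le k\le n$ let ${n\brack k}=\frac{[n]!}{[k]!\,[n-k]!}$. The Lupaş $q$-analogue of the Bernstein operator is, for $f\in C[0,1]$, $x\in[0,1]$, $n\ge1$, $$R_{n,q}(f,x)=\sum_{k=0}^{n} f\!\left(\tfrac{[k]}{[n]}\right) {n\brack k}\frac{q^{k(k-1)/2}x^{k}(1-x)^{n-k}}{(1-x+qx)\cdots(1-x+q^{n-1}x)}.$$ For $0<q<1$ the limit $q$-Lupaş operator is $R_{\infty,q}(f,x)=\sum_{k=0}^{\infty} f(1-q^{k})\,b_{\infty k}(q;x)$ if $x\in[0,1)$ and $R_{\infty,q}(f,1)=f(1)$, where $$b_{\infty k}(q;x)=\frac{q^{k(k-1)/2}\,(x/(1-x))^{k}}{(1-q)^{k}[k]!\prod_{j=0}^{\infty}\left(1+q^{j}\,x/(1-x)\right)}.$$ Further, $v(q,x)=\frac{qx}{1-x+qx}$, and $\omega(f,t)=\sup_{|x-y|\le t}|f(x)-f(y)|$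 ($x,y\in[0,1]$) is the modulus of continuity. *)

(* Defs.v *)
From mathcomp Require Import all_boot all_order all_algebra.
From mathcomp Require Import all_classical all_reals all_analysis.

Set Implicit Arguments.
Unset Strict Implicit.
Unset Printing Implicit Defensive.

Import Order.TTheory GRing.Theory Num.Theory.
Import numFieldNormedType.Exports.

Local Open Scope classical_set_scope.
Local Open Scope ring_scope.

Definition qint (R : realType) (q : R) (n : nat) : R := \sum_(0 <= i < n) q ^+ i.

Definition qfact (R : realType) (q : R) (n : nat) : R :=
  \prod_(1 <= i < n.+1) qint q i.

(* Only meaningful for k <= n. *)
Definition qbinom (R : realType) (q : R) (n k : nat) : R :=
  qfact q n / (qfact q k * qfact q (n - k)).

(* Functions on [0, 1] are represented by functions R -> R whose values outside
   [0, 1] are irrelevant. *)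
Definition lupas (R : realType) (n : nat) (q : R) (f : R -> R) (x : R) : R :=
  \sum_(0 <= k < n.+1)
    f (qint q k / qint q n) * qbinom q n k *
    (q ^+ ((k * k.-1) %/ 2) * x ^+ k * (1 - x) ^+ (n - k) /
     \prod_(1 <= j < n) (1 - x + q ^+ j * x)).

Definition lupas_inf_basis (R : realType) (q : R) (k : nat) (x : R) : R :=
  q ^+ ((k * k.-1) %/ 2) * (x / (1 - x)) ^+ k /
  ((1 - q) ^+ k * qfact q k *
   limn (fun m : nat => \prod_(0 <= j < m) (1 + q ^+ j * (x / (1 - x))))).

Definition lupas_inf (R : realType) (q : R) (f : R -> R) (x : R) : R :=
  if x == 1 then f 1
  else limn (series (fun k : nat => f (1 - q ^+ k) * lupas_inf_basis q k x)).

Definition vq (R : realType) (q x : R) : R := q * x / (1 - x + q * x).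

(* Modulus of continuity on [0, 1]; the supremum is taken in R, so it is
   meaningful for f bounded on [0, 1]. *)
Definition modulus (R : realType) (f : R -> R) (t : R) : R :=
  sup [set r | exists x y : R,
    [/\ 0 <= x <= 1, 0 <= y <= 1, `|x - y| <= t & r = `|f x - f y|]].

(* f1 is the derivative of f on [0, 1], one-sided at the endpoints: the limit of
   the difference quotient at x is taken over y in [0, 1] with y <> x. *)
Definition deriv_on01 (R : realType) (f f1 : R -> R) : Prop :=
  forall x : R, 0 <= x <= 1 ->
    (fun y : R => (f y - f x) / (y - x)) @ within `[0, 1] x^' --> f1 x.

(* f is in C^2[0, 1] with f' = f1 and f'' = f2 on [0, 1], where f1 and f2 are
   uniquely determined by f. *)
Definition C2_on01 (R : realType) (f f1 f2 : R -> R) : Prop :=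
  [/\ deriv_on01 f f1, deriv_on01 f1 f2 & {within `[0, 1], continuous f2}].

(* Main.v *)
(*
Degree elevation writes each node value of R_{m+1} as a convex combination of
two node values of R_m, so R_m h >= R_{m+1} h for h convex: R_n - R_m (n <= m)
is a positive functional on convex functions. If w is the modulus of f'' at
[n]^{-1/2}, then |f''(t) - f''(x)| <= w (1 + [n] (t - x)^2), so G + g and G - g
are convex for G = w (t^2/2 + [n] (t - x)^4/12) and g = f - f''(x) t^2/2, whence
|(R_n - R_m) g| <= (R_n - R_m) G. It remains to see that, with a = 1/[n] and
b = 1/[m],
  (R_n - R_m) t^2 = x (1 - v) (a - b) and
  (R_n - R_m) (t - x)^4 <= 200 a x (1 - v) (a - b).
The second bound follows from convexity of 6 t^2 - (t - x)^4 if q < 1/2, and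
from the explicit moments if q >= 1/2. Finally R_m f tends to the limit operator
by dominated convergence, and a - b to a - (1 - q) = q^n/[n].
*)
Require Import Defs.
From mathcomp Require Import all_boot all_order all_algebra.
From mathcomp Require Import all_classical all_reals all_analysis.
From mathcomp Require Import ring lra.

Set Implicit Arguments.
Unset Strict Implicit.
Unset Printing Implicit Defensive.

Import Order.TTheory GRing.Theory Num.Theory.
Import numFieldNormedType.Exports.

Local Open Scope classical_set_scope.
Local Open Scope ring_scope.

(** * q-integers and Lupaş weights *)

Lemma qint0 (R : realType) (q : R) : qint q 0 = 0.
Proof. by rewrite /qint big_geq. Qed.

Lemma qintSr (R : realType) (q : R) n : qint q n.+1 = qint q n + q ^+ n.
Proof. by rewrite /qint big_nat_recr. Qed.

Lemma qintD (R : realType) (q : R) m n :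
  qint q (m + n) = qint q m + q ^+ m * qint q n.
Proof.
elim: n => [|n IH]; first by rewrite addn0 qint0 mulr0 addr0.
by rewrite addnS !qintSr IH exprD mulrDr addrA.
Qed.

Lemma qintS (R : realType) (q : R) n : qint q n.+1 = 1 + q * qint q n.
Proof. by rewrite -add1n qintD qintSr qint0 expr1 expr0 add0r. Qed.

Lemma qint_mulB1 (R : realType) (q : R) n : (1 - q) * qint q n = 1 - q ^+ n.
Proof. by elim: n => [|n IH]; rewrite ?qint0 ?qintSr ?exprS; [ring|lra]. Qed.

Lemma qint_gt0 (R : realType) (q : R) n : 0 < q -> 0 < qint q n.+1.
Proof.
move=> q0; elim: n => [|n IH]; rewrite qintS ?qint0; first by rewrite mulr0 addr0.
by rewrite ltr_wpDr// ltW// mulr_gt0.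
Qed.

Lemma qint_ge0 (R : realType) (q : R) n : 0 < q -> 0 <= qint q n.
Proof. by case: n => [|n] q0; [rewrite qint0|rewrite ltW// qint_gt0]. Qed.

Lemma qfactS (R : realType) (q : R) n : qfact q n.+1 = qfact q n * qint q n.+1.
Proof. by rewrite /qfact big_nat_recr. Qed.

Lemma qfact0 (R : realType) (q : R) : qfact q 0 = 1.
Proof. by rewrite /qfact big_geq. Qed.

Lemma qfact_gt0 (R : realType) (q : R) n : 0 < q -> 0 < qfact q n.
Proof.
by move=> q0; elim: n => [|n IH]; rewrite ?qfact0// qfactS mulr_gt0// qint_gt0.
Qed.

(* With u = x / (1 - x), the numerator of the k-th Lupaş basis function divided
   by (1 - x)^n; lprod is the matching denominator. *)
Definition lweight (R : realType) (q : R) (n k : nat) (u : R) : R :=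
  qbinom q n k * q ^+ ((k * k.-1) %/ 2) * u ^+ k.

Definition lprod (R : realType) (q : R) (n : nat) (u : R) : R :=
  \prod_(0 <= j < n) (1 + q ^+ j * u).

(** It takes a sequence of node values instead of a function, so that moments can be reindexed in k.
    It is a mean because the weights sum to [lprod]. *)
Definition lmean (R : realType) (q : R) (n : nat) (u : R) (g : nat -> R) : R :=
  (\sum_(0 <= k < n.+1) g k * lweight q n k u) / lprod q n u.

Lemma triangleS k : ((k.+1 * k) %/ 2 = (k * k.-1) %/ 2 + k)%N.
Proof. by rewrite !divn2 -[X in (X./2)%N]/(k.+1 * k.+1.-1)%N -!bin2 binS bin1. Qed.

Lemma lprod_ge1 (R : realType) (q : R) n (u : R) :
  0 < q -> 0 <= u -> 1 <= lprod q n u.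
Proof.
move=> q0 u0; elim: n => [|n IH]; first by rewrite /lprod big_geq.
rewrite /lprod big_nat_recr//= mulr_ege1// lerDl mulr_ge0// exprn_ge0// ltW//.
Qed.

Lemma lprod_gt0 (R : realType) (q : R) n (u : R) :
  0 < q -> 0 <= u -> 0 < lprod q n u.
Proof. by move=> q0 u0; rewrite (lt_le_trans _ (lprod_ge1 _ _ _)). Qed.

Lemma lprodS (R : realType) (q : R) n (u : R) :
  lprod q n.+1 u = (1 + u) * lprod q n (q * u).
Proof.
rewrite /lprod big_nat_recl//= expr0 mul1r; congr (_ * _).
by apply: eq_bigr => i _; rewrite exprSr mulrA.
Qed.

Lemma lweight_ge0 (R : realType) (q : R) n k (u : R) :
  0 < q -> 0 <= u -> 0 <= lweight q n k u.
Proof.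
move=> q0 u0; rewrite /lweight /qbinom.
have F k' : 0 <= qfact q k' by rewrite ltW// qfact_gt0.
have q0' := ltW q0.
by rewrite !mulr_ge0 ?invr_ge0 ?mulr_ge0 ?exprn_ge0.
Qed.

(** Since q^n = q^k q^(n-k), the summands 1 and q^n u of the factor on the left give the two terms
    on the right, by the ratios of neighbouring q-binomials. *)
Lemma lweight_elevation (R : realType) (q : R) n k (u : R) : 0 < q -> (k <= n)%N ->
  lweight q n k u * (1 + q ^+ n * u) =
  qint q (n.+1 - k) / qint q n.+1 * lweight q n.+1 k u +
  q ^+ (n - k) * qint q k.+1 / qint q n.+1 * lweight q n.+1 k.+1 u.
Proof.
move=> q0 kn; rewrite /lweight triangleS /qbinom subSS subSn// !qfactS !exprD exprS.
have -> : q ^+ n = q ^+ k * q ^+ (n - k) by rewrite -exprD subnKC.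
have := qint_gt0 n q0; have := qint_gt0 k q0; have := qint_gt0 (n - k) q0.
have := qfact_gt0 (n - k) q0; have := qfact_gt0 k q0.
move=> a b c d e; field.
by rewrite !gt_eqF//.
Qed.

(** Absorption identity of the q-binomials; the q^k freed by the triangular exponent turns u^k into
    (q u)^k. *)
Lemma lweight_qint (R : realType) (q : R) n k (u : R) : 0 < q -> (k <= n)%N ->
  qint q k.+1 * lweight q n.+1 k.+1 u = qint q n.+1 * u * lweight q n k (q * u).
Proof.
move=> q0 kn; rewrite /lweight triangleS /qbinom subSS !qfactS exprD !exprS exprMn.
have := qint_gt0 k q0.
have := qfact_gt0 (n - k) q0; have := qfact_gt0 k q0.
move=> a b c; field.
by rewrite !gt_eqF//.
Qed.

Lemma lupasE (R : realType) (q : R) f n x : 0 < q -> 0 <= x < 1 -> (0 < n)%N ->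
  lupas n q f x = lmean q n (x / (1 - x)) (fun k => f (qint q k / qint q n)).
Proof.
move=> q0 /andP[x0 x1]; case: n => // n _.
have u0 : 0 <= x / (1 - x) by rewrite divr_ge0// subr_ge0 ltW.
have y0 : 1 - x != 0 by rewrite subr_eq0 gt_eqF.
have E : \prod_(1 <= j < n.+1) (1 - x + q ^+ j * x) =
         (1 - x) ^+ n.+1 * lprod q n.+1 (x / (1 - x)).
  (* The product in [lupas] starts at j = 1; the factor j = 0 would be (1 - x) (1 + u) = 1 with u =
     x / (1 - x). *)
  rewrite lprodS exprS mulrACA (_ : (1 - x) * _ = 1); last by field.
  rewrite mul1r -[in X in X * _](subn0 n) -prodr_const_nat -big_split/=.
  rewrite big_add1/=.
  by apply: eq_bigr => i _; rewrite exprS; field.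
rewrite /lupas /lmean E mulr_suml; apply: eq_big_nat => k /andP[_ kn].
have -> : (1 - x) ^+ n.+1 = (1 - x) ^+ (n.+1 - k) * (1 - x) ^+ k.
  by rewrite -exprD subnK.
have P := lprod_gt0 n.+1 q0 u0.
rewrite /lweight exprMn exprVn; field.
by rewrite !expf_neq0// gt_eqF.
Qed.

(** * Linearity, positivity and degree elevation of the Lupaş mean *)

Lemma eq_lmean (R : realType) (q : R) n (u : R) (g h : nat -> R) :
  (forall k, (k <= n)%N -> g k = h k) -> lmean q n u g = lmean q n u h.
Proof.
move=> gh; rewrite /lmean; congr (_ / _); apply: eq_big_nat => k /= kn.
by rewrite gh.
Qed.

Lemma lmeanD (R : realType) (q : R) n (u : R) (g h : nat -> R) :
  lmean q n u (fun k => g k + h k) = lmean q n u g + lmean q n u h.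
Proof.
rewrite /lmean -mulrDl -big_split/=; congr (_ / _).
by apply: eq_bigr => k _; rewrite mulrDl.
Qed.

Lemma lmeanZ (R : realType) (q : R) n (u : R) c (g : nat -> R) :
  lmean q n u (fun k => c * g k) = c * lmean q n u g.
Proof.
rewrite /lmean mulrA mulr_sumr; congr (_ / _).
by apply: eq_bigr => k _; rewrite mulrA.
Qed.

Lemma le_lmean (R : realType) (q : R) n (u : R) (g h : nat -> R) :
  0 < q -> 0 <= u -> (forall k, (k <= n)%N -> g k <= h k) ->
  lmean q n u g <= lmean q n u h.
Proof.
move=> q0 u0 gh; rewrite /lmean ler_pM2r ?invr_gt0 ?lprod_gt0//.
apply: ler_sum_nat => k /= kn.
by rewrite ler_wpM2r ?lweight_ge0// gh.
Qed.

Lemma lmean_elevation (R : realType) (q : R) n (u : R) (g : nat -> R) :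
  0 < q -> 0 <= u ->
  lmean q n u g = lmean q n.+1 u
    (fun k => qint q (n.+1 - k) / qint q n.+1 * g k +
              q ^+ (n.+1 - k) * qint q k / qint q n.+1 * g k.-1).
Proof.
(* The two end terms vanish because [0] = 0: both [g n.+1] and the value at the truncated [0.-1]
   carry coefficient zero. *)
move=> q0 u0; rewrite lmeanD /lmean [X in _ = X / _ + _]big_nat_recr//= subnn qint0.
rewrite [X in _ = _ + X / _]big_nat_recl//= qint0 -mulrDl.
rewrite !(mulr0, mul0r) addr0 add0r -big_split/=.
have -> : lprod q n.+1 u = lprod q n u * (1 + q ^+ n * u).
  by rewrite /lprod big_nat_recr.
have P : 0 < 1 + q ^+ n * u by rewrite ltr_wpDr// mulr_ge0// exprn_ge0// ltW.
rewrite -[LHS](mulfK (lt0r_neq0 P)) invfM [RHS]mulrA; congr (_ / _).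
rewrite [LHS]mulrAC; congr (_ / _).
rewrite mulr_suml; apply: eq_big_nat => k /= kn.
rewrite -[LHS]mulrA lweight_elevation// subSS; ring.
Qed.

(** The two coefficients of degree elevation add up to 1, so the total mass is that of n = 0. *)
Lemma lmean1 (R : realType) (q : R) n (u : R) : 0 < q -> 0 <= u ->
  lmean q n u (fun=> 1) = 1.
Proof.
move=> q0 u0; elim: n => [|n IH].
  rewrite /lmean /lprod big_nat1 big_geq// /lweight /qbinom subnn qfact0/=.
  by rewrite !(mulr1, divr1, expr0, invr1).
rewrite -[RHS]IH [RHS]lmean_elevation//; apply: eq_lmean => k kn.
rewrite !mulr1 -mulrDl -qintD subnK// divff// gt_eqF// qint_gt0//.
Qed.

Lemma lmean_cst (R : realType) (q : R) n (u : R) c : 0 < q -> 0 <= u ->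
  lmean q n u (fun=> c) = c.
Proof.
move=> q0 u0; rewrite -[RHS]mulr1 -(lmean1 n q0 u0) -lmeanZ.
by apply: eq_lmean => k _; rewrite mulr1.
Qed.

(** * Monotonicity on convex functions *)

Definition convex01 (R : realType) (h : R -> R) : Prop :=
  forall a b w, 0 <= a <= 1 -> 0 <= b <= 1 -> 0 <= w <= 1 ->
    h (w * a + (1 - w) * b) <= w * h a + (1 - w) * h b.

Lemma qint_le (R : realType) (q : R) m n : 0 < q -> (m <= n)%N ->
  qint q m <= qint q n.
Proof.
move=> q0 mn; rewrite -(subnKC mn) qintD lerDl mulr_ge0// ?qint_ge0//.
by rewrite exprn_ge0// ltW.
Qed.

Lemma qnode_itv (R : realType) (q : R) k n : 0 < q -> (k <= n)%N ->
  0 <= qint q k / qint q n <= 1.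
Proof.
move=> q0; case: n => [|n] kn; first by rewrite qint0 invr0 mulr0 lexx ler01.
rewrite divr_ge0 ?qint_ge0//= ler_pdivrMr ?qint_gt0// mul1r.
exact: qint_le.
Qed.

(** After elevation, the node [k]/[n+2] is the combination of [k]/[n+1] and [k-1]/[n+1] with the
    elevation coefficients as weights, and Jensen applies termwise. *)
Lemma lmean_convexS (R : realType) (q : R) n (u : R) (h : R -> R) :
  0 < q -> 0 <= u -> convex01 h ->
  lmean q n.+2 u (fun k => h (qint q k / qint q n.+2)) <=
  lmean q n.+1 u (fun k => h (qint q k / qint q n.+1)).
Proof.
move=> q0 u0 hc; rewrite [leRHS]lmean_elevation//; apply: le_lmean => // k kn.
have N1 := qint_gt0 n q0; have N2 := qint_gt0 n.+1 q0.
have Nk := qint_ge0 k q0.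
(* For k = n + 2 the point [k]/[n+1] lies outside [0, 1], where convexity says nothing; its weight
   is 0 and both sides are h 1. *)
have [->|kn1] := eqVneq k n.+2.
  rewrite subnn qint0 expr0 !mul0r add0r mul1r /=.
  by rewrite !divff ?gt_eqF// mul1r.
have {kn1}kn1 : (k <= n.+1)%N by rewrite -ltnS ltn_neqAle kn1.
set w := qint q (n.+2 - k) / qint q n.+2.
have E : qint q n.+2 = qint q (n.+2 - k) + q ^+ (n.+2 - k) * qint q k.
  by rewrite -qintD subnK.
have -> : q ^+ (n.+2 - k) * qint q k / qint q n.+2 = 1 - w.
  apply/eqP; rewrite eq_sym subr_eq /w -mulrDl addrC -E divff// gt_eqF//.
have w01 : 0 <= w <= 1 by apply: qnode_itv => //; exact: leq_subr.
have km : (k.-1 <= n.+1)%N by rewrite (leq_trans (leq_pred k)).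
suff -> : qint q k / qint q n.+2 =
    w * (qint q k / qint q n.+1) + (1 - w) * (qint q k.-1 / qint q n.+1).
  by apply: hc => //; exact: qnode_itv.
rewrite /w; case: (k) kn1 E => [|j] jn E; first by rewrite /= qint0 !mul0r !mulr0 addr0.
have F : qint q n.+1 = qint q (n.+2 - j.+1) + q ^+ (n.+2 - j.+1) * qint q j.
  by rewrite -qintD subSS subnK// ltnW.
rewrite /=; move: E F N1 N2.
set s := qint q (n.+2 - _); set p := q ^+ _ => E F N1 N2.
have -> : 1 - s / qint q n.+2 = p * qint q j.+1 / qint q n.+2.
  apply/eqP; rewrite subr_eq -mulrDl addrC -E divff// gt_eqF//.
transitivity (qint q j.+1 / qint q n.+2 * ((s + p * qint q j) / qint q n.+1)).
  by rewrite -F divff ?mulr1// gt_eqF.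
by field; rewrite !gt_eqF.
Qed.

Lemma lmean_convex (R : realType) (q : R) m n (u : R) (h : R -> R) :
  0 < q -> 0 <= u -> convex01 h -> (0 < n <= m)%N ->
  lmean q m u (fun k => h (qint q k / qint q m)) <=
  lmean q n u (fun k => h (qint q k / qint q n)).
Proof.
move=> q0 u0 hc /andP[n0 nm]; rewrite -(subnK nm).
case: n n0 {nm} => // n _.
elim: (m - n.+1)%N => // d IH; rewrite addSn.
by apply: le_trans IH; rewrite !addnS; exact: lmean_convexS.
Qed.

(** * Moments *)

(* lp u = x when u = x / (1 - x), and lp (q u) is then v(q, x). *)
Definition lp (R : realType) (u : R) : R := u / (1 + u).

(** [lweight_qint] summed over k. It trades a factor [k] for the passage from (n + 1, u) to (n, q
    u), and so lowers the degree of a moment by one. *)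
Lemma lmean_shift (R : realType) (q : R) n (u : R) (h g : nat -> R) :
  0 < q -> 0 <= u -> h 0 = 0 -> (forall k, h k.+1 = qint q k.+1 * g k) ->
  lmean q n.+1 u h = qint q n.+1 * lp u * lmean q n (q * u) g.
Proof.
move=> q0 u0 h0 hS; rewrite /lmean big_nat_recl//= h0 !mul0r add0r lprodS.
have u1 : 0 < 1 + u by rewrite ltr_wpDr.
have P : 0 < lprod q n (q * u) by rewrite lprod_gt0// mulr_ge0// ltW.
rewrite (_ : \sum_(0 <= i < n.+1) _ = qint q n.+1 * u *
   \sum_(0 <= k < n.+1) g k * lweight q n k (q * u)).
  by rewrite /lp; field; rewrite !gt_eqF.
rewrite mulr_sumr; apply: eq_big_nat => k /= kn.
by rewrite hS mulrAC lweight_qint//; ring.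
Qed.

Lemma lmean_cubic (R : realType) (q : R) n (u : R) c0 c1 c2 c3 :
  0 < q -> 0 <= u ->
  lmean q n u (fun k => c0 + c1 * qint q k + c2 * qint q k ^+ 2 +
                        c3 * qint q k ^+ 3) =
  c0 + c1 * lmean q n u (fun k => qint q k) +
  c2 * lmean q n u (fun k => qint q k ^+ 2) +
  c3 * lmean q n u (fun k => qint q k ^+ 3).
Proof. by move=> q0 u0; rewrite !lmeanD !lmeanZ lmean_cst. Qed.

(** By [k+1] = 1 + q [k], powers of [k+1] are polynomials in [k]; cubic ones suffice for moments up
    to the fourth. At n = 0 the truncated [n.-1] is harmless because [0] = 0. *)
Lemma lmean_shift_cubic (R : realType) (q : R) n (u : R) (h : nat -> R)
    c0 c1 c2 c3 :
  0 < q -> 0 <= u -> h 0 = 0 ->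
  (forall k, h k.+1 = qint q k.+1 *
    (c0 + c1 * qint q k + c2 * qint q k ^+ 2 + c3 * qint q k ^+ 3)) ->
  lmean q n u h = qint q n * lp u *
    (c0 + c1 * lmean q n.-1 (q * u) (fun k => qint q k) +
    c2 * lmean q n.-1 (q * u) (fun k => qint q k ^+ 2) +
    c3 * lmean q n.-1 (q * u) (fun k => qint q k ^+ 3)).
Proof.
move=> q0 u0 h0 hS; case: n => [|n].
  by rewrite /lmean big_nat1 h0 qint0 !mul0r.
by rewrite -lmean_cubic ?mulr_ge0 ?(ltW q0)//=; apply: lmean_shift.
Qed.

Lemma lmean_m1 (R : realType) (q : R) n (u : R) : 0 < q -> 0 <= u ->
  lmean q n u (fun k => qint q k) = qint q n * lp u.
Proof.
move=> q0 u0; rewrite (@lmean_shift_cubic _ _ _ _ _ 1 0 0 0)// ?qint0//.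
  by ring.
by move=> k; ring.
Qed.

Lemma lmean_m2 (R : realType) (q : R) n (u : R) : 0 < q -> 0 <= u ->
  lmean q n u (fun k => qint q k ^+ 2) =
  qint q n * lp u * (1 + q * (qint q n.-1 * lp (q * u))).
Proof.
move=> q0 u0; have qu0 : 0 <= q * u by rewrite mulr_ge0// ltW.
rewrite (@lmean_shift_cubic _ _ _ _ _ 1 q 0 0)// ?qint0 ?expr0n//.
  by rewrite lmean_m1//; ring.
by move=> k; rewrite qintS; ring.
Qed.

Lemma lmean_m3 (R : realType) (q : R) n (u : R) : 0 < q -> 0 <= u ->
  lmean q n u (fun k => qint q k ^+ 3) =
  qint q n * lp u * (1 + 2 * q * (qint q n.-1 * lp (q * u)) +
   q ^+ 2 * (qint q n.-1 * lp (q * u) *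
     (1 + q * (qint q n.-2 * lp (q ^+ 2 * u))))).
Proof.
move=> q0 u0; have qu0 : 0 <= q * u by rewrite mulr_ge0// ltW.
rewrite (@lmean_shift_cubic _ _ _ _ _ 1 (2 * q) (q ^+ 2) 0)// ?qint0 ?expr0n//.
  have -> : q ^+ 2 * u = q * (q * u) by ring.
  by rewrite lmean_m1// lmean_m2//; ring.
by move=> k; rewrite qintS; ring.
Qed.

Lemma lmean_m4 (R : realType) (q : R) n (u : R) : 0 < q -> 0 <= u ->
  lmean q n u (fun k => qint q k ^+ 4) =
  qint q n * lp u * (1 + 3 * q * (qint q n.-1 * lp (q * u)) +
   3 * q ^+ 2 * (qint q n.-1 * lp (q * u) *
     (1 + q * (qint q n.-2 * lp (q ^+ 2 * u)))) +
   q ^+ 3 * (qint q n.-1 * lp (q * u) *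
     (1 + 2 * q * (qint q n.-2 * lp (q ^+ 2 * u)) +
      q ^+ 2 * (qint q n.-2 * lp (q ^+ 2 * u) *
       (1 + q * (qint q n.-2.-1 * lp (q ^+ 3 * u))))))).
Proof.
move=> q0 u0; have qu0 : 0 <= q * u by rewrite mulr_ge0// ltW.
rewrite (@lmean_shift_cubic _ _ _ _ _ 1 (3 * q) (3 * q ^+ 2) (q ^+ 3))//
  ?qint0 ?expr0n//; last by move=> k; rewrite qintS; ring.
rewrite lmean_m1// lmean_m2// lmean_m3//.
have -> : q ^+ 3 * u = q ^+ 2 * (q * u) by ring.
have -> : q ^+ 2 * u = q * (q * u) by ring.
by ring.
Qed.

(** This and the next two: q-falling factorials as polynomials in [n], from q [n-1] = [n] - 1 and
    its iterates. For small n, where predecessors are truncated, both sides vanish. *)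
Lemma qint_falling2 (R : realType) (q : R) n :
  q * qint q n.-1 * qint q n = (qint q n - 1) * qint q n.
Proof. by case: n => [|n]; rewrite ?qint0 ?mulr0//= qintS; ring. Qed.

Lemma qint_falling3 (R : realType) (q : R) n :
  q * qint q n.-1 * (q ^+ 2 * qint q n.-2) * qint q n =
  (qint q n - 1) * (qint q n - 1 - q) * qint q n.
Proof.
by case: n => [|[|n]]; rewrite /= ?qint0 ?mulr0// !qintS ?qint0; ring.
Qed.

Lemma qint_falling4 (R : realType) (q : R) n :
  q * qint q n.-1 * (q ^+ 2 * qint q n.-2) * (q ^+ 3 * qint q n.-2.-1) * qint q n =
  (qint q n - 1) * (qint q n - 1 - q) * (qint q n - 1 - q - q ^+ 2) * qint q n.
Proof.
by case: n => [|[|[|n]]]; rewrite /= ?qint0 ?mulr0// !qintS ?qint0; ring.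
Qed.

(** Affine in 1/[n] with slope [lp u * (1 - lp (q * u))]: this is where the factor x (1 - v) of the
    theorem comes from. *)
Lemma lmean_sq_node (R : realType) (q : R) n (u : R) :
  0 < q -> 0 <= u -> (0 < n)%N ->
  lmean q n u (fun k => (qint q k / qint q n) ^+ 2) =
  lp u * ((qint q n)^-1 + (1 - (qint q n)^-1) * lp (q * u)).
Proof.
move=> q0 u0; case: n => // n _.
have N := lt0r_neq0 (qint_gt0 n q0).
rewrite (@eq_lmean _ _ _ _ _ (fun k => (qint q n.+1)^-1 ^+ 2 * qint q k ^+ 2)).
  by rewrite lmeanZ lmean_m2//= qintS in N *; field.
by move=> k _; rewrite exprMn mulrC.
Qed.

(* The fourth central moment of the nodes [k]/[n] under the Lupaş weights, as a
   cubic polynomial in a = 1/[n]; v_j stands for lp (q^j u). *)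
Definition quartic_moment (R : realType) (q x v1 v2 v3 a : R) : R :=
  x * (a ^+ 3 + (3 + 3 * q + q ^+ 2) * a ^+ 2 * (1 - a) * v1
    + (3 + 2 * q + q ^+ 2) * a * (1 - a) * (1 - (1 + q) * a) * v1 * v2
    + (1 - a) * (1 - (1 + q) * a) * (1 - (1 + q + q ^+ 2) * a) * v1 * v2 * v3)
  - 4 * x ^+ 2 * (a ^+ 2 + (2 + q) * a * (1 - a) * v1
      + (1 - a) * (1 - (1 + q) * a) * v1 * v2)
  + 6 * x ^+ 3 * (a + (1 - a) * v1) - 3 * x ^+ 4.

Lemma lmean_quartic_node (R : realType) (q : R) n (u : R) x v1 v2 v3 a :
  0 < q -> 0 <= u -> (0 < n)%N ->
  x = lp u -> v1 = lp (q * u) -> v2 = lp (q ^+ 2 * u) -> v3 = lp (q ^+ 3 * u) ->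
  a = (qint q n)^-1 ->
  lmean q n u (fun k => (qint q k / qint q n - x) ^+ 4) =
  quartic_moment q x v1 v2 v3 a.
Proof.
move=> q0 u0; case: n => // n _ xE v1E v2E v3E aE.
have N := lt0r_neq0 (qint_gt0 n q0).
rewrite (@eq_lmean _ _ _ _ _ (fun k => (x ^+ 4 + (- 4 * x ^+ 3 * a) * qint q k +
   (6 * x ^+ 2 * a ^+ 2) * qint q k ^+ 2 + (- 4 * x * a ^+ 3) * qint q k ^+ 3) +
   a ^+ 4 * qint q k ^+ 4)); last by move=> k _; rewrite -aE; ring.
rewrite lmeanD lmeanZ lmean_cubic// lmean_m1// lmean_m2// lmean_m3// lmean_m4//.
rewrite -xE -v1E -v2E -v3E /quartic_moment.
have := qint_falling2 q n.+1; have := qint_falling3 q n.+1.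
have := qint_falling4 q n.+1; rewrite aE.
move: N; rewrite /=.
set N := qint q n.+1; set N1 := qint q n; set N2 := qint q n.-1; set N3 := qint q n.-2.
move=> N0 F4 F3 F2.
(* The moments are regrouped so that every monomial contains a full q-falling factorial, which then
   becomes a polynomial in [n]. *)
set E4 := N * x * (1 + 3 * q * (N1 * v1) + _ + _).
have {E4}-> : E4 = x * (N + (3 + 3 * q + q ^+ 2) * v1 * (q * N1 * N) +
    (3 + 2 * q + q ^+ 2) * v1 * v2 * (q * N1 * (q ^+ 2 * N2) * N) +
    v1 * v2 * v3 * (q * N1 * (q ^+ 2 * N2) * (q ^+ 3 * N3) * N)).
  by rewrite /E4; ring.
set E3 := N * x * (1 + 2 * q * (N1 * v1) + _).
have {E3}-> : E3 = x * (N + (2 + q) * v1 * (q * N1 * N) +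
    v1 * v2 * (q * N1 * (q ^+ 2 * N2) * N)).
  by rewrite /E3; ring.
have -> : N * x * (1 + q * (N1 * v1)) = x * (N + v1 * (q * N1 * N)) by ring.
by rewrite F4 F3 F2; field.
Qed.

Lemma lp_itv (R : realType) (u : R) : 0 <= u -> 0 <= lp u < 1.
Proof.
move=> u0; have u1 : 0 < 1 + u by rewrite ltr_wpDr.
by rewrite /lp divr_ge0 ?(ltW u1)//= ltr_pdivrMr// mul1r ltrDr.
Qed.

(** Consecutive values v_j = [lp (q ^+ j * u)] differ by a multiple of 1 - q; this drives the
    cancellation for q near 1. *)
Lemma lp_qstep (R : realType) (q u : R) : 0 < q -> 0 <= u ->
  lp u = lp (q * u) + (1 - q) * lp u * (1 - lp (q * u)).
Proof.
move=> q0 u0; have u1 : 0 < 1 + u by rewrite ltr_wpDr.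
have qu1 : 0 < 1 + q * u by rewrite ltr_wpDr// mulr_ge0// ltW.
by rewrite /lp; field; rewrite !gt_eqF.
Qed.

(** * Coefficientwise bounds for the quartic moment *)

Lemma mulr_itv01 (R : realType) (x y : R) :
  0 <= x <= 1 -> 0 <= y <= 1 -> 0 <= x * y <= 1.
Proof.
by move=> /andP[x0 x1] /andP[y0 y1]; rewrite mulr_ge0//= mulr_ile1.
Qed.

(** The coefficient of a in [quartic_moment], divided by x, with A, B, C = 1 - v1, 1 - v2, 1 - v3.
    It vanishes at q = 1, where all v_j coincide; the factor 1 - q in the bound is essential, since
    1 - q is later bounded by a. *)
Lemma quartic_moment_linear_coef (R : realType) (q x A B C : R) :
  2^-1 <= q <= 1 -> 0 <= x <= 1 -> 0 <= A <= 1 -> 0 <= B <= 1 -> 0 <= C <= 1 ->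
  x = 1 - A + (1 - q) * x * A -> 1 - A = 1 - B + (1 - q) * (1 - A) * B ->
  1 - B = 1 - C + (1 - q) * (1 - B) * C -> B <= 2 * A -> C <= 4 * A ->
  (3 + 2 * q + q ^+ 2) * (1 - A) * (1 - B) * C
    - 4 * x * (2 + q) * (1 - A) * B + 6 * x ^+ 2 * A <= 50 * ((1 - q) * A).
Proof.
move=> /andP[q0 q1] x01 A01 B01 C01 E1 E2 E3 B2 C4.
have w01 (X : R) : 0 <= X <= 1 -> 0 <= 1 - X <= 1.
  by move=> /andP[? ?]; rewrite subr_ge0 gerBl; apply/andP.
have e01 : 0 <= 1 - q <= 1 by apply: w01; rewrite q1 andbT; lra.
have sq (X : R) : 0 <= X <= 1 -> 0 <= X ^+ 2 <= 1.
  by move=> h; rewrite expr2; exact: mulr_itv01.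
have V1 := w01 _ A01; have V2 := w01 _ B01; have V3 := w01 _ C01.
pose e := 1 - q; pose v1 := 1 - A; pose v2 := 1 - B.
(* Replacing x, v2 by v1 and B, C by A at the cost of multiples of e, the three products become 6,
   -12 and 6 times v1^2 A, which cancel; only terms with a factor e remain. *)
have D : (3 + 2 * q + q ^+ 2) * v1 * v2 * C
    - 4 * x * (2 + q) * v1 * B + 6 * x ^+ 2 * A =
  e * (6 * (- (v1 ^+ 2 * B ^+ 2) + v1 * v2 ^+ 2 * C - 2 * x * v1 * A * B
     + 2 * x * v1 * A ^+ 2 + e * x ^+ 2 * A ^+ 3 - v1 ^+ 3 * B)
     + (e - 4) * v1 * v2 * C + 4 * x * v1 * B).
  have H1 : x = v1 + e * x * A by exact: E1.
  have H2 : v1 = v2 + e * v1 * B by exact: E2.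
  have H3 : v2 = (1 - C) + e * v2 * C by exact: E3.
  have HC : C = B + e * v2 * C by move: H3; rewrite /v2; lra.
  have HB : B = A + e * v1 * B by move: H2; rewrite /v1 /v2; lra.
  have K1 : v1 * v2 * C = v1 * v2 * B + e * v1 * v2 ^+ 2 * C.
    by rewrite {1}HC; ring.
  have K2 : v1 * v2 * B = v1 ^+ 2 * B - e * v1 ^+ 2 * B ^+ 2.
    by rewrite (_ : v2 = v1 - e * v1 * B); [ring|rewrite {1}H2; ring].
  have K3 : x * v1 * B = v1 ^+ 2 * B + e * x * v1 * A * B.
    by rewrite {1}H1; ring.
  have K4 : x ^+ 2 * A = v1 ^+ 2 * A + 2 * e * x * v1 * A ^+ 2 + e ^+ 2 * x ^+ 2 * A ^+ 3.
    by rewrite {1}H1; rewrite (_ : (v1 + e * x * A) ^+ 2 =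
      v1 ^+ 2 + 2 * v1 * (e * x * A) + (e * x * A) ^+ 2); ring.
  have K5 : v1 ^+ 2 * B = v1 ^+ 2 * A + e * v1 ^+ 3 * B.
    by rewrite {1}HB; ring.
  have -> : q = 1 - e by rewrite /e; ring.
  rewrite (_ : _ - _ + _ =
    (6 - 4 * e + e ^+ 2) * (v1 * v2 * C) - 4 * (3 - e) * (x * v1 * B) + 6 * (x ^+ 2 * A)); last by ring.
  rewrite (_ : (6 - 4 * e + e ^+ 2) * (v1 * v2 * C) =
    6 * (v1 * v2 * C) + e * (e - 4) * (v1 * v2 * C)); last by ring.
  rewrite {1}K1 K2 (_ : 4 * (3 - e) * (x * v1 * B) =
    12 * (x * v1 * B) - 4 * e * (x * v1 * B)); last by ring.
  rewrite {1}K3 K4 {1}K5; lra.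
rewrite -/v1 -/v2 D -/e [leRHS]mulrCA ler_wpM2l//; first by case/andP: e01.
have m1 : 0 <= v1 * v2 ^+ 2 <= 1 by apply: mulr_itv01 => //; exact: sq.
have m2 : 0 <= x * v1 * A <= 1 by do 2?apply: mulr_itv01.
have m3 : 0 <= e * x ^+ 2 * A ^+ 2 <= 1.
  by do 2?apply: mulr_itv01 => //; exact: sq.
have m4 : 0 <= x * v1 <= 1 by apply: mulr_itv01.
have le1 (m X : R) : 0 <= m <= 1 -> 0 <= X <= 1 -> m * X <= X.
  by move=> /andP[? ?] /andP[? ?]; exact: ler_piMl.
(* The positive terms amount to at most 6 C + 18 A + 4 B, hence 50 A by B <= 2 A and C <= 4 A; the
   others are dropped by sign. *)
have t1 := le1 _ _ m1 C01; have t2 := le1 _ _ m2 A01.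
have t3 := le1 _ _ m3 A01; have t4 := le1 _ _ m4 B01.
have /andP[n1 _] : 0 <= v1 ^+ 2 * B ^+ 2 <= 1 by apply: mulr_itv01; exact: sq.
have /andP[n2 _] : 0 <= (x * v1 * A) * B <= 1 by apply: mulr_itv01.
have /andP[n3 _] : 0 <= (v1 ^+ 2 * v1) * B <= 1.
  by do 2?apply: mulr_itv01 => //; exact: sq.
have /andP[n4 _] : 0 <= v1 * v2 * C <= 1 by do 2?apply: mulr_itv01.
have n5 : 0 <= (4 - e) * (v1 * v2 * C).
  case/andP: e01 => _ e1; rewrite mulr_ge0// subr_ge0 (le_trans e1)//; lra.
lra.
Qed.

(** The coefficient of a^2, divided by x. It splits into a multiple of B, whose positive
    coefficients sum to 3 + 3 + 1 + 4 + 4 = 15, minus a nonnegative rest. *)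
Lemma quartic_moment_quadratic_coef (R : realType) (q x A B C : R) :
  0 <= q <= 1 -> 0 <= x <= 1 -> 0 <= A <= 1 -> 0 <= B <= 1 -> 0 <= C <= 1 ->
  (3 + 3 * q + q ^+ 2) * (1 - A)
  - (3 + 2 * q + q ^+ 2) * (2 + q) * (1 - A) * (1 - B)
  + (3 + 4 * q + 3 * q ^+ 2 + q ^+ 3) * (1 - A) * (1 - B) * (1 - C)
  - 4 * x * (1 - (2 + q) * (1 - A) + (1 + q) * (1 - A) * (1 - B)) <= 15 * B.
Proof.
move=> q01 x01 A01 B01 C01.
have w01 (X : R) : 0 <= X <= 1 -> 0 <= 1 - X <= 1.
  by move=> /andP[? ?]; rewrite subr_ge0 gerBl; apply/andP.
have V1 := w01 _ A01; have V2 := w01 _ B01.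
rewrite (_ : _ - _ = (3 * (1 - A) + 3 * (q * (1 - A)) + q ^+ 2 * (1 - A)
    + 4 * (x * (1 - A)) + 4 * (x * q * (1 - A))) * B
  - ((3 + 4 * q + 3 * q ^+ 2 + q ^+ 3) * ((1 - A) * (1 - B) * C) + 4 * (x * A)));
  last by ring.
have q2 : 0 <= q ^+ 2 <= 1 by rewrite expr2; exact: mulr_itv01.
have /andP[_ m1] := mulr_itv01 q01 V1; have /andP[_ m2] := mulr_itv01 q2 V1.
have /andP[_ m3] := mulr_itv01 x01 V1.
have /andP[_ m4] := mulr_itv01 (mulr_itv01 x01 q01) V1.
have /andP[n1 _] := mulr_itv01 (mulr_itv01 V1 V2) C01.
have /andP[n2 _] := mulr_itv01 x01 A01.
case/andP: q01 => q0 q1; case/andP: B01 => B0 B1; case/andP: V1 => _ V1.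
rewrite lerBlDr; apply: ler_wpDr; last first.
  by rewrite ler_wpM2r//; lra.
apply: addr_ge0; apply: mulr_ge0 => //.
by rewrite !addr_ge0 ?mulr_ge0 ?exprn_ge0.
Qed.

(** The coefficient of a^3, divided by x; the 6 is 1 + 2 + 2 + 1, from (1 + q) (1 + q + q^2) at q =
    1. *)
Lemma quartic_moment_cubic_coef (R : realType) (q A B C : R) :
  0 <= q <= 1 -> 0 <= A <= 1 -> 0 <= B <= 1 -> 0 <= C <= 1 ->
  1 - (3 + 3 * q + q ^+ 2) * (1 - A)
  + (3 + 2 * q + q ^+ 2) * (1 + q) * (1 - A) * (1 - B)
  - (1 + q) * (1 + q + q ^+ 2) * (1 - A) * (1 - B) * (1 - C) <= A + 6 * C.
Proof.
move=> q01 A01 B01 C01.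
have w01 (X : R) : 0 <= X <= 1 -> 0 <= 1 - X <= 1.
  by move=> /andP[? ?]; rewrite subr_ge0 gerBl; apply/andP.
have V1 := w01 _ A01; have V2 := w01 _ B01.
rewrite (_ : _ - _ = A - (2 + 3 * q + q ^+ 2) * ((1 - A) * B)
   + (1 + 2 * q + 2 * q ^+ 2 + q ^+ 3) * ((1 - A) * (1 - B)) * C); last by ring.
have q2 : 0 <= q ^+ 2 <= 1 by rewrite expr2; exact: mulr_itv01.
have q3 : 0 <= q ^+ 3 <= 1 by rewrite exprS; exact: mulr_itv01.
have /andP[m0 m1] := mulr_itv01 V1 V2.
have /andP[n1 _] := mulr_itv01 V1 B01.
case/andP: q01 => q0 q1; case/andP: C01 => C0 C1.
case/andP: q2 => q20 q21; case/andP: q3 => q30 q31.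
apply: lerD.
  by rewrite gerBl mulr_ge0// !addr_ge0// mulr_ge0.
rewrite ler_wpM2r// -[leRHS]mulr1 ler_pM// ?addr_ge0 ?mulr_ge0//; lra.
Qed.

(** The difference is (a - b) x times c1 + c2 (a + b) + c3 (a^2 + a b + b^2). By 1 - q <= a, B <= 2
    A, C <= 4 A and a <= 1 the three terms are at most 50, 60 and 75 times a A. *)
Lemma quartic_moment_lipschitz (R : realType) (q u x v1 v2 v3 a b : R) :
  2^-1 <= q < 1 -> 0 <= u -> 1 - q <= b -> b <= a -> a <= 1 ->
  x = lp u -> v1 = lp (q * u) -> v2 = lp (q ^+ 2 * u) -> v3 = lp (q ^+ 3 * u) ->
  quartic_moment q x v1 v2 v3 a - quartic_moment q x v1 v2 v3 b <=
  200 * a * (a - b) * x * (1 - v1).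
Proof.
move=> /andP[qh q1] u0 qb ba a1 xE v1E v2E v3E.
have q0 : 0 < q by rewrite (lt_le_trans _ qh)// invr_gt0.
have qu k : 0 <= q ^+ k * u by rewrite mulr_ge0// exprn_ge0// ltW.
have /andP[x0 x1] : 0 <= x < 1 by rewrite xE; exact: lp_itv.
have /andP[v10 v11] : 0 <= v1 < 1 by rewrite v1E; apply: lp_itv; exact: (qu 1).
have /andP[v20 v21] : 0 <= v2 < 1 by rewrite v2E; apply: lp_itv; exact: (qu 2).
have /andP[v30 v31] : 0 <= v3 < 1 by rewrite v3E; apply: lp_itv; exact: (qu 3).
have E1 : x = v1 + (1 - q) * x * (1 - v1) by rewrite xE v1E; exact: lp_qstep.
have E2 : v1 = v2 + (1 - q) * v1 * (1 - v2).
  have -> : v2 = lp (q * (q * u)) by rewrite v2E expr2 mulrA.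
  rewrite v1E; apply: lp_qstep => //; exact: (qu 1).
have E3 : v2 = v3 + (1 - q) * v2 * (1 - v3).
  have -> : v3 = lp (q * (q ^+ 2 * u)) by rewrite v3E exprS mulrA.
  rewrite v2E; apply: lp_qstep => //; exact: (qu 2).
pose A := 1 - v1; pose B := 1 - v2; pose C := 1 - v3.
have vA : v1 = 1 - A by rewrite /A; ring.
have vB : v2 = 1 - B by rewrite /B; ring.
have vC : v3 = 1 - C by rewrite /C; ring.
(* E2 reads A = B - (1 - q) v1 B, and 1 - q <= 1/2. *)
have B2 : B <= 2 * A.
  have : (1 - q) * v1 * B <= 2^-1 * 1 * B.
    rewrite ler_wpM2r ?subr_ge0 ?(ltW v21)// ler_pM//; lra.
  by rewrite /A /B in E2 *; lra.
have C2 : C <= 2 * B.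
  have : (1 - q) * v2 * C <= 2^-1 * 1 * C.
    rewrite ler_wpM2r ?subr_ge0 ?(ltW v31)// ler_pM//; lra.
  by rewrite /B /C in E3 *; lra.
have A01 : 0 <= A <= 1 by rewrite /A; apply/andP; lra.
have B01 : 0 <= B <= 1 by rewrite /B; apply/andP; lra.
have C01 : 0 <= C <= 1 by rewrite /C; apply/andP; lra.
have q01 : 0 <= q <= 1 by rewrite !ltW.
have x01 : 0 <= x <= 1 by rewrite x0 ltW.
rewrite -/A.
have L1 := @quartic_moment_linear_coef _ q x A B C.
have {}L1 := L1 (introT andP (conj qh (ltW q1))) x01 A01 B01 C01.
rewrite -vA -vB -vC in L1.
have {}L1 := L1 E1 E2 E3 B2 (ltac:(lra) : C <= 4 * A).
have := quartic_moment_quadratic_coef q01 x01 A01 B01 C01.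
have := quartic_moment_cubic_coef q01 A01 B01 C01.
rewrite -vA -vB -vC.
move: L1; set c1 := (X in X <= _) => L1.
set c3 := (X in X <= _) => L3; set c2 := (X in X <= _) => L2.
rewrite (_ : _ - _ = (a - b) * x *
  (c1 + c2 * (a + b) + c3 * (a ^+ 2 + a * b + b ^+ 2))); last first.
  by rewrite /quartic_moment /c1 /c2 /c3 /A /B /C; ring.
rewrite (_ : 200 * _ * _ * _ * _ = (a - b) * x * (200 * (a * A))); last by ring.
rewrite ler_wpM2l// ?mulr_ge0 ?subr_ge0//.
have b0 : 0 <= b by rewrite (le_trans _ qb)// subr_ge0 ltW.
have a0 : 0 <= a by exact: le_trans ba.
case/andP: A01 => A0 _.
have k1 : c1 <= 50 * (a * A).
  rewrite (le_trans L1)// ler_pM2l// ler_wpM2r//; exact: le_trans ba.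
have k2 : c2 * (a + b) <= 30 * A * (2 * a).
  rewrite (@le_trans _ _ (30 * A * (a + b)))//.
    by rewrite ler_wpM2r ?addr_ge0//; lra.
  by rewrite ler_wpM2l ?mulr_ge0//; lra.
have k3 : c3 * (a ^+ 2 + a * b + b ^+ 2) <= 25 * A * (3 * a).
  rewrite (@le_trans _ _ (25 * A * (a ^+ 2 + a * b + b ^+ 2)))//.
    by rewrite ler_wpM2r ?addr_ge0 ?exprn_ge0 ?mulr_ge0//; lra.
  rewrite ler_wpM2l ?mulr_ge0//; nra.
have aA : 0 <= a * A by rewrite mulr_ge0.
lra.
Qed.

(** * Calculus on [0, 1] *)

(** Clearing the denominator also covers y = x. *)
Lemma deriv_on01_within (R : realType) (f f1 : R -> R) (x e : R) :
  deriv_on01 f f1 -> 0 <= x <= 1 -> 0 < e ->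
  exists2 d, 0 < d & forall y, 0 <= y <= 1 -> `|y - x| < d ->
    `|f y - f x - f1 x * (y - x)| <= e * `|y - x|.
Proof.
move=> df x01 e0; have /cvgrPdist_le/(_ e e0) := df x x01.
rewrite /prop_near1 /within/= => /nbhs_ballP[d d0 H].
exists d => // y y01 yx; have [->|yNx] := eqVneq y x.
  by rewrite !subrr mulr0 subr0 normr0 mulr0.
have yx0 : y - x != 0 by rewrite subr_eq0.
have : `|f1 x - (f y - f x) / (y - x)| <= e.
  by apply: (H y) => //=; rewrite ?in_itv// /ball/= distrC.
rewrite -(ler_pM2r (_ : 0 < `|y - x|)) ?normr_gt0// -normrM.
by rewrite mulrBl divfK// distrC.
Qed.

Lemma deriv_on01_is_derive (R : realType) (f f1 : R -> R) (x : R) :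
  deriv_on01 f f1 -> 0 < x < 1 -> is_derive x (1 : R) f (f1 x).
Proof.
move=> df /andP[x0 x1].
suff H : (fun h => h^-1 *: ((f \o shift x) (h *: (1 : R)) - f x)) @ 0^' --> f1 x.
  by apply: DeriveDef; [apply/cvg_ex; exists (f1 x)|exact/cvg_lim].
apply/cvgrPdist_le => e e0.
have x01 : 0 <= x <= 1 by rewrite !ltW.
have [d d0 H] := deriv_on01_within df x01 e0.
near=> h.
have h0 : h != 0 by near: h; exact: nbhs_dnbhs_neq.
have hd : `|h| < d by near: h; apply: dnbhs0_lt.
have hx : `|h| < x by near: h; apply: dnbhs0_lt.
have hx1 : `|h| < 1 - x by near: h; apply: dnbhs0_lt; rewrite subr_gt0.
have := H (h + x); rewrite addrK => /(_ _ hd) {}H.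
have {}H : `|f (h + x) - f x - f1 x * h| <= e * `|h|.
  by apply: H; move: hx hx1; rewrite !ltr_norml => /andP[? ?] /andP[? ?]; apply/andP; lra.
rewrite /= -(ler_pM2r (_ : 0 < `|h|)) ?normr_gt0// -normrM.
by rewrite /GRing.scale/= mulr1 mulrBl mulrAC mulVf// mul1r distrC.
Unshelve. all: by end_near. Qed.

Lemma deriv_on01_continuous (R : realType) (f f1 : R -> R) :
  deriv_on01 f f1 -> {within `[0, 1], continuous f}.
Proof.
move=> df; apply/subspace_continuousP => x; rewrite /= in_itv/= => x01.
apply/cvgrPdist_le => e e0.
have [d d0 H] := deriv_on01_within df x01 ltr01.
rewrite near_withinE; near=> y; rewrite /= in_itv/= => y01.
have yd : `|y - x| < d.
  by near: y; apply/nbhs_ballP; exists d => // z; rewrite /ball/= distrC.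
have ye : `|y - x| < e / (1 + `|f1 x|).
  near: y; apply/nbhs_ballP; exists (e / (1 + `|f1 x|)).
    by rewrite /= divr_gt0// ltr_wpDr.
  by move=> z; rewrite /ball/= distrC.
have := H _ y01 yd; rewrite mul1r => {}H.
rewrite distrC (_ : f y - f x = (f y - f x - f1 x * (y - x)) + f1 x * (y - x)); last by ring.
rewrite (le_trans (ler_normD _ _))// normrM.
rewrite (@le_trans _ _ ((1 + `|f1 x|) * `|y - x|))//.
  by rewrite mulrDl mul1r lerD2r.
by rewrite mulrC -ler_pdivlMr ?ltW// ltr_wpDr.
Unshelve. all: by end_near. Qed.

(** The mean value theorem makes h1 nondecreasing; used again on both sides of c = w a + (1 - w) b,
    it writes the convexity gap as w (1 - w) (b - a) (h1 t - h1 s) with s <= c <= t. *)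
Lemma convex01_derive2 (R : realType) (h h1 h2 : R -> R) :
  {within `[0, 1], continuous h} -> {within `[0, 1], continuous h1} ->
  (forall x : R, 0 < x < 1 -> is_derive x (1 : R) h (h1 x)) ->
  (forall x : R, 0 < x < 1 -> is_derive x (1 : R) h1 (h2 x)) ->
  (forall x : R, 0 < x < 1 -> 0 <= h2 x) -> convex01 h.
Proof.
move=> ch ch1 dh dh1 h20.
have sub (a b : R) : 0 <= a -> b <= 1 -> `[a, b] `<=` `[0, 1].
  by move=> a0 b1 t /=; rewrite !in_itv/= => /andP[? ?]; apply/andP; lra.
have oo (a b : R) x : 0 <= a -> b <= 1 -> x \in `]a, b[ -> 0 < x < 1.
  by move=> a0 b1; rewrite in_itv/= => /andP[? ?]; apply/andP; lra.
have mono (a b : R) : 0 <= a -> a <= b -> b <= 1 -> h1 a <= h1 b.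
  rewrite le_eqVlt => a0; rewrite le_eqVlt => /predU1P[->//|ab] b1.
  have a0' : 0 <= a by rewrite le_eqVlt.
  have [||c cab E] := @MVT _ h1 h2 a b ab.
  - by move=> t /oo; move=> /(_ a0' b1); exact: dh1.
  - exact: continuous_subspaceW (sub _ _ a0' b1) ch1.
  rewrite -subr_ge0 E mulr_ge0// ?subr_ge0; last exact: ltW.
  exact: (h20 _ (oo _ _ _ a0' b1 cab)).
suff H (a b w : R) : 0 <= a -> a <= b -> b <= 1 -> 0 <= w <= 1 ->
    h (w * a + (1 - w) * b) <= w * h a + (1 - w) * h b.
  move=> a b w /andP[a0 a1] /andP[b0 b1] /andP[w0 w1].
  have [ab|/ltW ba] := leP a b; first by apply: H => //; apply/andP.
  have := H b a (1 - w) b0 ba a1; rewrite subKr.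
  rewrite [X in h X]addrC [X in _ -> _ <= X]addrC.
  by rewrite addrC; apply; apply/andP; lra.
move=> a0 ab b1 /andP[w0 w1]; set c := w * a + (1 - w) * b.
have ca : c - a = (1 - w) * (b - a) by rewrite /c; ring.
have bc : b - c = w * (b - a) by rewrite /c; ring.
have ac : a <= c by rewrite -subr_ge0 ca mulr_ge0// subr_ge0.
have cb : c <= b by rewrite -subr_ge0 bc mulr_ge0// subr_ge0.
have [||s sac E1] := @MVT_segment _ h h1 a c ac.
- by move=> t /oo; move=> /(_ a0 (le_trans cb b1)); exact: dh.
- exact: continuous_subspaceW (sub _ _ a0 (le_trans cb b1)) ch.
have [||t tcb E2] := @MVT_segment _ h h1 c b cb.
- by move=> t /oo; move=> /(_ (le_trans a0 ac) b1); exact: dh.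
- exact: continuous_subspaceW (sub _ _ (le_trans a0 ac) b1) ch.
move: sac tcb; rewrite !in_itv/= => /andP[as_ sc] /andP[ct tb].
have st : h1 s <= h1 t.
  by apply: mono; [exact: le_trans as_|exact: le_trans ct|exact: le_trans b1].
rewrite -subr_ge0 (_ : _ - _ = w * (1 - w) * (b - a) * (h1 t - h1 s)).
  by rewrite !mulr_ge0// subr_ge0.
transitivity ((1 - w) * (h b - h c) - w * (h c - h a)); first by ring.
by rewrite E1 E2 ca bc; ring.
Qed.

(** At most 1 + r steps of length d lead from x to t, where r = |t - x| / d, and r <= r^2 once r >=
    1. *)
Lemma modulus_quadratic (R : realType) (f : R -> R) (d x t : R) :
  {within `[0, 1], continuous f} -> 0 < d -> 0 <= x <= 1 -> 0 <= t <= 1 ->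
  `|f t - f x| <= modulus f d * (1 + (t - x) ^+ 2 / d ^+ 2).
Proof.
move=> cf d0 x01 t01; set w := modulus f d.
have w1 (y z : R) : 0 <= y <= 1 -> 0 <= z <= 1 -> `|y - z| <= d -> `|f y - f z| <= w.
  (* The supremum bounds its set only if the set is bounded, which the extreme value theorem
     provides. *)
  move=> y01 z01 yz; apply: sup_upper_bound; last by exists y, z.
  split; first by exists `|f y - f z|, y, z.
  have [M _ HM] := EVT_max ler01 cf; have [m _ Hm] := EVT_min ler01 cf.
  exists (f M - f m) => _ [a [b [a01 b01 _ ->]]].
  have := HM a; have := HM b; have := Hm a; have := Hm b; rewrite !in_itv/=.
  move=> /(_ b01) ? /(_ a01) ? /(_ b01) ? /(_ a01) ?.
  by rewrite ler_norml; apply/andP; lra.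
have w0 : 0 <= w.
  by apply: le_trans (w1 x x x01 x01 _); rewrite ?normr_ge0// subrr normr0 ltW.
have chain k (y : R) : 0 <= y <= 1 -> `|y - x| <= k%:R * d -> `|f y - f x| <= k%:R * w.
  elim: k y => [|k IH] y y01.
    by rewrite mul0r normr_le0 subr_eq0 => /eqP ->; rewrite subrr normr0 mul0r.
  (* z lies at the fraction k / (k + 1) of the way from x to y: within k d of x and within d of
     y. *)
  move=> yx; pose z := x + (y - x) * (k%:R / k.+1%:R).
  have kp : 0 < k.+1%:R :> R by rewrite ltr0n.
  have r01 : 0 <= (k%:R / k.+1%:R : R) <= 1.
    by rewrite divr_ge0//= ler_pdivrMr// mul1r ler_nat.
  have z01 : 0 <= z <= 1.
    case/andP: r01 => r0 r1; case/andP: x01 => ? ?; case/andP: y01 => ? ?.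
    rewrite /z; move: (_ / _) r0 r1 => r r0 r1.
    rewrite (_ : x + _ = (1 - r) * x + r * y); last by ring.
    rewrite addr_ge0 ?mulr_ge0 ?subr_ge0//= -subr_ge0.
    rewrite (_ : _ - _ = (1 - r) * (1 - x) + r * (1 - y)); last by ring.
    by rewrite addr_ge0 ?mulr_ge0 ?subr_ge0.
  have zx : `|z - x| <= k%:R * d.
    rewrite /z addrAC subrr add0r normrM (@ger0_norm _ (_ / _)) ?divr_ge0//.
    by rewrite mulrA ler_pdivrMr// mulrC -mulrA ler_wpM2l// mulrC.
  have yz : `|y - z| <= d.
    rewrite (_ : y - z = (y - x) / k.+1%:R); last first.
      by rewrite /z -natr1; field; rewrite natr1 gt_eqF.
    by rewrite normrM (@ger0_norm _ (_^-1))// ler_pdivrMr// mulrC.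
  rewrite -[k.+1]addn1 natrD mulrDl mul1r [leRHS]addrC.
  rewrite (_ : f y - f x = (f y - f z) + (f z - f x)); last by ring.
  by rewrite (le_trans (ler_normD _ _))// lerD// ?w1// IH.
have [tx|tx] := leP `|t - x| d.
  rewrite (le_trans (w1 _ _ t01 x01 tx))// ler_peMr// lerDl.
  by rewrite divr_ge0 ?sqr_ge0.
set r := `|t - x| / d.
have r1 : 1 <= r by rewrite /r ler_pdivlMr// mul1r ltW.
have rE : (t - x) ^+ 2 / d ^+ 2 = r ^+ 2 by rewrite /r exprMn exprVn real_normK// num_real.
have /andP[k1 k2] := truncn_itv (le_trans ler01 r1).
have := chain (Num.truncn r).+1 t t01; rewrite -ler_pdivrMr// => /(_ (ltW k2)) H.
rewrite (le_trans H)// mulrC ler_wpM2l// rE -natr1 addrC lerD2l.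
by rewrite (le_trans k1)// expr2 ler_peMl// (le_trans ler01).
Qed.

(** * Convergence to the limit operator *)

(** Cut at a fixed N: the head converges termwise, and both tails are at most the tail [T N] of the
    dominating series. *)
Lemma tannery (R : realType) (A : nat -> nat -> R) (a M : nat -> R) :
  (forall m k, (k <= m)%N -> `|A m k| <= M k) -> cvgn (series M) ->
  (forall k, A ^~ k @ \oo --> a k) ->
  (fun m => \sum_(0 <= k < m.+1) A m k) @ \oo --> limn (series a).
Proof.
move=> AM cM Aa.
have aM k : `|a k| <= M k.
  apply: (cvgr_to_le (cvg_norm (Aa k))).
  by near=> m; apply: AM; near: m; exact: nbhs_infty_ge.
have M0 k : 0 <= M k by apply: le_trans (aM k).
have ca : cvgn (series a).
  by apply: normed_cvg; apply: (series_le_cvg _ M0 aM cM) => k.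
pose T N := limn (series M) - series M N.
have part (c : nat -> R) N n : (N <= n)%N ->
    (forall k, (k < n)%N -> `|c k| <= M k) -> `|\sum_(N <= k < n) c k| <= T N.
  move=> Nn cM'; apply: (le_trans (ler_norm_sum _ _ _)).
  apply: (@le_trans _ _ (\sum_(N <= k < n) M k)).
    by apply: ler_sum_nat => k /andP[_ kn]; exact: cM'.
  rewrite -sub_series_geq// lerB// nondecreasing_cvgn_le//.
  by apply: nondecreasing_series.
have tail N : `|limn (series a) - series a N| <= T N.
  have H : (fun n => `|series a n - series a N|) @ \oo --> `|limn (series a) - series a N|.
    by apply: cvg_norm; apply: cvgB; [exact: ca|exact: cvg_cst].
  apply: (cvgr_to_le H); near=> n.
  have Nn : (N <= n)%N by near: n; exact: nbhs_infty_ge.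
  by rewrite sub_series_geq//; apply: part => // k _.
apply/cvgrPdist_le => e e0.
have e3 : 0 < e / 3 by rewrite divr_gt0.
have /cvgrPdist_le /(_ _ e3)[N _ /(_ N (leqnn N)) HN] := cM.
have {HN}TN : T N <= e / 3 by apply: le_trans HN; exact: ler_norm.
have H : (fun m => \sum_(0 <= k < N) A m k) @ \oo --> series a N.
  rewrite /series/=; elim: N {TN} => [|N IH].
    rewrite big_geq//; under eq_fun do rewrite big_geq//; exact: cvg_cst.
  by rewrite big_nat_recr//=; under eq_fun do rewrite big_nat_recr//=; exact: cvgD.
near=> m.
have Nm : (N <= m.+1)%N by near: m; exists N => // k /= /leqW.
rewrite (big_cat_nat (n := N))//=.
have h1 : `|series a N - \sum_(0 <= k < N) A m k| <= e / 3.
  by near: m; by move/cvgrPdist_le : H; apply.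
have h2 : `|\sum_(N <= k < m.+1) A m k| <= T N.
  by apply: (part (A m)) => // k; rewrite ltnS; exact: AM.
have h3 := tail N.
move: h1 h2 h3; rewrite !ler_norml => /andP[? ?] /andP[? ?] /andP[? ?].
by apply/andP; lra.
Unshelve. all: by end_near. Qed.

Lemma qint_ub (R : realType) (q : R) n : 0 < q < 1 -> qint q n <= (1 - q)^-1.
Proof.
move=> /andP[q0 q1]; rewrite -[leRHS]mul1r ler_pdivlMr ?subr_gt0// mulrC.
by rewrite qint_mulB1 gerBl exprn_ge0// ltW.
Qed.

Lemma qint_cvg (R : realType) (q : R) : 0 < q < 1 ->
  qint q n @[n --> \oo] --> (1 - q)^-1.
Proof.
move=> /andP[q0 q1].
have -> : qint q = (fun n => (1 - q ^+ n) / (1 - q)).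
  by apply/funext => n; rewrite -qint_mulB1 mulrC mulKf// subr_eq0 gt_eqF.
rewrite -[X in _ --> X]mul1r; apply: cvgMr_tmp.
rewrite -[X in _ --> X]subr0; apply: cvgB; first exact: cvg_cst.
by apply: cvg_expr; rewrite ger0_norm// ltW.
Qed.

(** Once n is shifted by k, [n+k]!/[n]! is a product of k q-integers, each tending to 1 / (1 -
    q). *)
Lemma qbinom_cvg (R : realType) (q : R) k : 0 < q < 1 ->
  qbinom q n k @[n --> \oo] --> ((1 - q) ^+ k * qfact q k)^-1.
Proof.
move=> q01; have /andP[q0 q1] := q01.
rewrite -(cvg_shiftn k).
have -> : (fun n => qbinom q (n + k) k) =
          (fun n => qfact q (n + k) / qfact q n * (qfact q k)^-1).
  apply/funext => n; rewrite /qbinom addnK invfM; ring.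
rewrite invfM; apply: cvgMr_tmp.
elim: k => [|k IH].
  rewrite expr0 invr1 (_ : (fun n => _) = fun=> 1); first exact: cvg_cst.
  by apply/funext => n; rewrite addn0 divff// gt_eqF// qfact_gt0.
rewrite (_ : (fun n => _) = (fun n => qfact q (n + k) / qfact q n * qint q (n + k.+1))).
  rewrite exprSr invfM; apply: cvgM => //.
  rewrite (cvg_shiftn k.+1 (qint q)); exact: qint_cvg.
by apply/funext => n; rewrite addnS qfactS mulrAC.
Qed.

(** The q-binomial theorem, read off from the total mass 1. *)
Lemma sum_lweight (R : realType) (q : R) n (u : R) : 0 < q -> 0 <= u ->
  \sum_(0 <= k < n.+1) lweight q n k u = lprod q n u.
Proof.
move=> q0 u0; have P := lt0r_neq0 (lprod_gt0 n q0 u0).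
apply: (mulIf (invr_neq0 P)); rewrite divff// -[RHS](lmean1 n q0 u0) /lmean.
by congr (_ / _); apply: eq_bigr => k _; rewrite mul1r.
Qed.

(** 1 + t <= exp t in each factor, the exponents adding up to u [n]. *)
Lemma lprod_ub (R : realType) (q : R) n (u : R) : 0 < q < 1 -> 0 <= u ->
  lprod q n u <= expR (u / (1 - q)).
Proof.
move=> q01 u0; have /andP[q0 q1] := q01.
apply: (@le_trans _ _ (expR (u * qint q n))); last first.
  by rewrite ler_expR ler_wpM2l// qint_ub.
elim: n => [|n IH]; first by rewrite /lprod big_geq// qint0 mulr0 expR0.
rewrite /lprod big_nat_recr//= qintSr [X in expR X]mulrDr expRD ler_pM//.
- by rewrite ltW// lprod_gt0.
- by rewrite addr_ge0// mulr_ge0// exprn_ge0// ltW.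
- by rewrite [u * _]mulrC expR_ge1Dx.
Qed.

Lemma lprod_cvg (R : realType) (q u : R) : 0 < q < 1 -> 0 <= u ->
  cvgn (fun n => lprod q n u).
Proof.
move=> q01 u0; have /andP[q0 q1] := q01.
apply: nondecreasing_is_cvgn.
  apply/nondecreasing_seqP => n; rewrite /lprod big_nat_recr//= ler_peMr//.
    by rewrite ltW// lprod_gt0.
  by rewrite lerDl mulr_ge0// exprn_ge0// ltW.
by exists (expR (u / (1 - q))) => _ [n _ <-]; exact: lprod_ub.
Qed.

Lemma lprod_lim_gt0 (R : realType) (q u : R) : 0 < q < 1 -> 0 <= u ->
  0 < limn (fun n => lprod q n u).
Proof.
move=> q01 u0; have /andP[q0 q1] := q01.
apply: (lt_le_trans ltr01); apply: limr_ge; first exact: lprod_cvg.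
by near=> n; exact: lprod_ge1.
Unshelve. all: by end_near. Qed.

(* Rescaling u to 2u turns the total mass into a geometric bound on each weight. *)
Lemma lweight_ub (R : realType) (q : R) n k (u : R) :
  0 < q < 1 -> 0 <= u -> (k <= n)%N ->
  lweight q n k u <= expR (2 * u / (1 - q)) * 2^-1 ^+ k.
Proof.
move=> q01 u0 kn; have /andP[q0 q1] := q01.
have u20 : 0 <= 2 * u by rewrite mulr_ge0.
have -> : lweight q n k u = lweight q n k (2 * u) * 2^-1 ^+ k.
  rewrite /lweight exprMn exprVn; field.
  by rewrite expf_neq0.
rewrite ler_wpM2r// ?exprn_ge0//.
apply: le_trans (lprod_ub n q01 u20); rewrite -sum_lweight//.
rewrite (big_cat_nat (n := k))//= ?leqW// (big_cat_nat (m := k) (n := k.+1))//= big_nat1.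
rewrite addrCA lerDl addr_ge0// sumr_ge0// => i _; exact: lweight_ge0.
Qed.

Lemma node_cvg (R : realType) (q : R) (f : R -> R) k :
  0 < q < 1 -> {within `[0, 1], continuous f} ->
  f (qint q k / qint q n) @[n --> \oo] --> f (1 - q ^+ k).
Proof.
move=> q01 /subspace_continuousP cf; have /andP[q0 q1] := q01.
have y01 : `[0, 1]%classic (1 - q ^+ k).
  have [? ?] := (ltW q0, ltW q1).
  by rewrite /= in_itv/= subr_ge0 gerBl exprn_ge0// exprn_ile1.
have nodey : qint q k / qint q n @[n --> \oo] --> 1 - q ^+ k.
  rewrite -qint_mulB1 mulrC; apply: cvgMl_tmp.
  rewrite -[1 - q]invrK; apply: cvgV; last exact: qint_cvg.
  by rewrite invr_eq0 subr_eq0 gt_eqF.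
apply/cvgrPdist_le => e e0.
have /cvgrPdist_le /(_ _ e0) := cf _ y01.
rewrite near_withinE => /nodey[N _ HN].
(* n >= k keeps the node in [0, 1], the only place where f is known to be continuous. *)
exists (maxn N k) => // n; rewrite /= geq_max => /andP[Nn kn].
by apply: (HN n Nn); rewrite /= in_itv/= qnode_itv.
Qed.

Lemma lmean_cvg (R : realType) (q : R) (f : R -> R) (x : R) :
  0 < q < 1 -> {within `[0, 1], continuous f} -> 0 <= x < 1 ->
  lmean q n (x / (1 - x)) (fun k => f (qint q k / qint q n)) @[n --> \oo] -->
  lupas_inf q f x.
Proof.
move=> q01 cf /andP[x0 x1]; have /andP[q0 q1] := q01.
rewrite /lupas_inf lt_eqF//; set u := x / (1 - x).
have u0 : 0 <= u by rewrite divr_ge0// subr_ge0 ltW.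
have [M HM] : exists M, forall y, 0 <= y <= 1 -> `|f y| <= M.
  have [M _ HM] := EVT_max ler01 cf; have [m _ Hm] := EVT_min ler01 cf.
  exists (`|f M| + `|f m|) => y y01.
  have := HM y; have := Hm y; rewrite !in_itv/= => /(_ y01) h1 /(_ y01) h2.
  have := ler_norm (f M); have := ler_norm (- f m); rewrite normrN ler_norml.
  have := normr_ge0 (f M); have := normr_ge0 (f m).
  by move=> *; apply/andP; lra.
have M0 : 0 <= M by apply: le_trans (HM 0 _); rewrite ?lexx ?ler01.
rewrite (_ : (fun n => _) = (fun n => \sum_(0 <= k < n.+1)
    f (qint q k / qint q n) * (lweight q n k u / lprod q n u))); last first.
  apply/funext => n; rewrite /lmean mulr_suml; apply: eq_bigr => k _.
  by rewrite mulrA.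
(* A geometric majorant, from |f| <= M, [lprod_ge1] and [lweight_ub]. *)
apply: (@tannery _ _ _ (fun k => M * expR (2 * u / (1 - q)) * 2^-1 ^+ k)).
- move=> m k km; rewrite normrM -mulrA ler_pM// ?HM ?qnode_itv//.
  rewrite ger0_norm; last by rewrite divr_ge0 ?lweight_ge0// ltW// lprod_gt0.
  rewrite ler_pdivrMr ?lprod_gt0// (le_trans (lweight_ub q01 u0 km))//.
  by rewrite ler_peMr ?lprod_ge1// mulr_ge0 ?expR_ge0 ?exprn_ge0.
- by apply: (is_cvg_geometric_series (z := 2^-1)); rewrite ger0_norm// invf_lt1// ltr1n.
- move=> k; apply: cvgM; first exact: node_cvg.
  rewrite /lupas_inf_basis -/u.
  rewrite (_ : _ / _ = ((1 - q) ^+ k * qfact q k)^-1 * q ^+ ((k * k.-1) %/ 2) * u ^+ k /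
      limn (fun n => lprod q n u)); last by rewrite invfM; ring.
  apply: cvgM; last by apply: cvgV; [rewrite gt_eqF// lprod_lim_gt0|exact: lprod_cvg].
  apply: cvgMr_tmp; apply: cvgMr_tmp; exact: qbinom_cvg.
Qed.

(** * Positivity argument *)

Lemma xquartic_deriv2 (R : comNzRingType) (a c x t : R) :
  (a *: 'X^2 + c *: ('X - x%:P) ^+ 4)^`()^`().[t] = 2 * a + 12 * c * (t - x) ^+ 2.
Proof.
set y := 'X - _; have y' : y^`() = 1 by exact: derivXsubC.
have yt : y.[t] = t - x by exact: hornerXsubC.
(* With y opaque, only its derivative 1 and its value t - x remain, and the power rule applies
   without expansion. *)
move: y y' yt => y y' yt.
rewrite !(derivD, derivZ, derivXn, derivMn, deriv_exp, y', mul1r).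
rewrite !(hornerD, hornerZ, hornerMn, horner_exp, hornerXn, yt) /=.
ring.
Qed.
Lemma xquarticE (R : comNzRingType) (a c x t : R) :
  (a *: 'X^2 + c *: ('X - x%:P) ^+ 4).[t] = a * t ^+ 2 + c * (t - x) ^+ 4.
Proof. by rewrite hornerD !hornerZ !horner_exp hornerXsubC hornerX. Qed.

Lemma convex01_polyD (R : realType) (p : {poly R}) (s : R) (f f1 f2 : R -> R) :
  C2_on01 f f1 f2 ->
  (forall t : R, 0 < t < 1 -> 0 <= p^`()^`().[t] + s * f2 t) ->
  convex01 (fun t => p.[t] + s * f t).
Proof.
move=> [df df1 _] H.
have cont (r : {poly R}) (g g1 : R -> R) : deriv_on01 g g1 ->
    {within `[0, 1], continuous (fun t => r.[t] + s * g t)}.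
  move=> dg t; apply: cvgD.
    by apply: continuous_subspaceT; exact: continuous_horner.
  by apply: cvgMl_tmp; exact: deriv_on01_continuous dg t.
have der (r : {poly R}) (g g1 : R -> R) (t : R) : deriv_on01 g g1 -> 0 < t < 1 ->
    is_derive t (1 : R) (fun t => r.[t] + s * g t) (r^`().[t] + s * g1 t).
  move=> dg t01; have dgt := deriv_on01_is_derive dg t01.
  by apply: is_deriveD.
apply: (convex01_derive2 (h1 := fun t => p^`().[t] + s * f1 t)
                         (h2 := fun t => p^`()^`().[t] + s * f2 t)) => //.
- exact: cont df.
- exact: cont df1.
- by move=> t; exact: der.
- by move=> t; exact: der.
Qed.

Lemma convex01_quarticD (R : realType) (a c x s : R) (f f1 f2 : R -> R) :
  C2_on01 f f1 f2 ->
  (forall t : R, 0 < t < 1 -> 0 <= 2 * a + 12 * c * (t - x) ^+ 2 + s * f2 t) ->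
  convex01 (fun t => a * t ^+ 2 + c * (t - x) ^+ 4 + s * f t).
Proof.
move=> C2 H; have := @convex01_polyD _ (a *: 'X^2 + c *: ('X - x%:P) ^+ 4) s _ _ _ C2.
under eq_fun do rewrite xquarticE.
by apply => t t01; rewrite xquartic_deriv2; exact: H.
Qed.

(** * Comparison of two Lupaş means *)

Lemma lmean_sq_nodeB (R : realType) (q : R) m n (u : R) :
  0 < q -> 0 <= u -> (0 < n)%N -> (0 < m)%N ->
  lmean q n u (fun k => (qint q k / qint q n) ^+ 2) -
  lmean q m u (fun k => (qint q k / qint q m) ^+ 2) =
  lp u * (1 - lp (q * u)) * ((qint q n)^-1 - (qint q m)^-1).
Proof. by move=> q0 u0 n0 m0; rewrite !lmean_sq_node//; ring. Qed.

Lemma lmean_quartic_nodeB (R : realType) (q u : R) m n (f f1 f2 : R -> R) :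
  C2_on01 f f1 f2 ->
  0 < q < 1 -> 0 <= u -> (0 < n <= m)%N ->
  lmean q n u (fun k => (qint q k / qint q n - lp u) ^+ 4) -
  lmean q m u (fun k => (qint q k / qint q m - lp u) ^+ 4) <=
  200 * (qint q n)^-1 *
    (lp u * (1 - lp (q * u)) * ((qint q n)^-1 - (qint q m)^-1)).
Proof.
move=> C2 q01 u0 /andP[n0 nm]; have /andP[q0 q1] := q01.
have m0 : (0 < m)%N by exact: leq_trans nm.
have N0 : 0 < qint q n by case: (n) n0 => // k _; exact: qint_gt0.
have M0 : 0 < qint q m by case: (m) m0 => // k _; exact: qint_gt0.
have ba : (qint q m)^-1 <= (qint q n)^-1 by rewrite lef_pV2 ?posrE// qint_le.
have [qh|qh] := leP 2^-1 q.
  rewrite !(@lmean_quartic_node _ q _ u (lp u) (lp (q * u))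
    (lp (q ^+ 2 * u)) (lp (q ^+ 3 * u)) _ q0 u0 _ erefl erefl erefl erefl erefl)//.
  have := @quartic_moment_lipschitz _ q u (lp u) (lp (q * u))
    (lp (q ^+ 2 * u)) (lp (q ^+ 3 * u)) (qint q n)^-1 (qint q m)^-1.
  move=> /(_ (introT andP (conj qh q1)) u0).
  rewrite (_ : _ * _ * (_ - _) * _ * _ =
    200 * (qint q n)^-1 * (lp u * (1 - lp (q * u)) * ((qint q n)^-1 - (qint q m)^-1))); last by ring.
  apply => //.
    by rewrite -[leLHS]invrK lef_pV2 ?posrE ?invr_gt0 ?subr_gt0// qint_ub.
  rewrite invf_le1//; case: (n) n0 => // k _.
  by rewrite qintS lerDl mulr_ge0 ?qint_ge0 ?ltW.
set x := lp u.
have /andP[x0 x1] : 0 <= x < 1 by exact: lp_itv.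
(* The second derivative 12 (1 - (t - x)^2) is nonnegative as |t - x| <= 1; the summand [0 * f t]
   fits the form of [convex01_quarticD]. *)
have cp : convex01 (fun t => 6 * t ^+ 2 + -1 * (t - x) ^+ 4 + 0 * f t).
  apply: convex01_quarticD C2 _ => t /andP[t0 t1].
  rewrite mul0r addr0 (_ : _ + _ = 12 * (1 - (t - x)) * (1 + (t - x))); last by ring.
  by rewrite !mulr_ge0//; lra.
have := lmean_convex q0 u0 cp (introT andP (conj n0 nm)).
rewrite !lmeanD !lmeanZ => H.
have S2 := lmean_sq_nodeB q0 u0 n0 m0.
(* For q < 1/2, [n] <= 1 / (1 - q) <= 2, so the constant 6 is well below 200 / [n]. *)
have N2 : 2^-1 <= (qint q n)^-1.
  rewrite lef_pV2 ?posrE// (le_trans (qint_ub n q01))//.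
  by rewrite invf_ple ?posrE ?subr_gt0//; lra.
set D := _ * _ * _ in S2 *.
have D0 : 0 <= D.
  have /andP[_ v1] : 0 <= lp (q * u) < 1 by apply: lp_itv; rewrite mulr_ge0// ltW.
  apply: mulr_ge0; last by rewrite subr_ge0.
  by apply: mulr_ge0 => //; rewrite subr_ge0 ltW.
have : 6 * D <= 200 * (qint q n)^-1 * D by rewrite ler_wpM2r//; lra.
lra.
Qed.

(** The theorem with R_m in place of the limit operator and before scaling by [n]/q^n. The constant
    does not depend on m, so the bound survives m tending to infinity. *)
Lemma lmean_voronovskaja (R : realType) (q u D : R) m n (f f1 f2 : R -> R) :
  C2_on01 f f1 f2 -> 0 < q < 1 -> 0 <= u -> (0 < n <= m)%N ->
  D = lp u * (1 - lp (q * u)) * ((qint q n)^-1 - (qint q m)^-1) ->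
  `|lmean q n u (fun k => f (qint q k / qint q n)) -
    lmean q m u (fun k => f (qint q k / qint q m)) - f2 (lp u) / 2 * D| <=
  20 * modulus f2 (qint q n `^ (- 2^-1)) * D.
Proof.
move=> C2 q01 u0 nm; have /andP[q0 q1] := q01; have /andP[n0 nm'] := nm.
set x := lp u => DE.
have m0 : (0 < m)%N by exact: leq_trans nm'.
have N0 : 0 < qint q n by case: (n) n0 => // k _; exact: qint_gt0.
have M0 : 0 < qint q m by case: (m) m0 => // k _; exact: qint_gt0.
have /andP[x0 x1] : 0 <= x < 1 by exact: lp_itv.
have x01 : 0 <= x <= 1 by rewrite x0 ltW.
have D0 : 0 <= D.
  have /andP[_ v1] : 0 <= lp (q * u) < 1 by apply: lp_itv; rewrite mulr_ge0// ltW.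
  rewrite DE; apply: mulr_ge0; last by rewrite subr_ge0 lef_pV2 ?posrE// qint_le.
  by apply: mulr_ge0 => //; rewrite subr_ge0 ltW.
set d := _ `^ _; set w := modulus f2 d.
have d0 : 0 < d by exact: powR_gt0.
have d2 : d ^- 2 = qint q n.
  by rewrite /d powRN powR12_sqrt ?ltW// exprVn invrK sqr_sqrtr// ltW.
have cf2 : {within `[0, 1], continuous f2} by case: C2.
have W t : 0 <= t <= 1 -> `|f2 t - f2 x| <= w * (1 + qint q n * (t - x) ^+ 2).
  by move=> t01; have := modulus_quadratic cf2 d0 x01 t01; rewrite d2 [_ * qint q n]mulrC.
have w0 : 0 <= w.
  by have := W x x01; rewrite !subrr normr0 expr0n mulr0 addr0 mulr1.
have S2 : lmean q n u (fun k => (qint q k / qint q n) ^+ 2) -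
  lmean q m u (fun k => (qint q k / qint q m) ^+ 2) = D by rewrite DE; exact: lmean_sq_nodeB.
have S4 := lmean_quartic_nodeB C2 q01 u0 nm; rewrite -/x -DE in S4.
(* The function is G + s g; its second derivative is w (1 + [n] (t - x)^2) + s (f2 t - f2 x),
   nonnegative by W. *)
have cvx s : `|s| <= 1 ->
    0 <= (w / 2 - s * f2 x / 2) * D + w * qint q n / 12 *
      (lmean q n u (fun k => (qint q k / qint q n - x) ^+ 4) -
       lmean q m u (fun k => (qint q k / qint q m - x) ^+ 4)) +
      s * (lmean q n u (fun k => f (qint q k / qint q n)) -
           lmean q m u (fun k => f (qint q k / qint q m))).
  move=> s1; rewrite -S2.
  have /(lmean_convex q0 u0)/(_ nm) : convex01 (fun t => (w / 2 - s * f2 x / 2) * t ^+ 2 +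
      w * qint q n / 12 * (t - x) ^+ 4 + s * f t).
    apply: convex01_quarticD C2 _ => t /andP[t0 t1].
    rewrite (_ : _ + _ = w * (1 + qint q n * (t - x) ^+ 2) + s * (f2 t - f2 x)); last by field.
    have /W H : 0 <= t <= 1 by rewrite !ltW.
    rewrite -lerBlDr sub0r; apply: le_trans H.
    rewrite (le_trans (ler_norm _))// normrN normrM.
    by rewrite ler_piMl.
  by rewrite !lmeanD !lmeanZ; lra.
(* The factor [n] cancels the 1/[n] of the quartic bound, leaving 200 / 12 <= 17. *)
have {}S4 : w * qint q n / 12 *
      (lmean q n u (fun k => (qint q k / qint q n - x) ^+ 4) -
       lmean q m u (fun k => (qint q k / qint q m - x) ^+ 4)) <= w * (17 * D).
  have NN : 0 <= w * qint q n / 12 by rewrite divr_ge0// mulr_ge0// ltW.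
  apply: le_trans (ler_wpM2l NN S4) _.
  rewrite [leLHS](_ : _ = w * (200 / 12 * D)); last by field; rewrite gt_eqF.
  by rewrite ler_wpM2l// ler_wpM2r//; lra.
(* The two signs give the two sides of the absolute value, with w / 2 + 17 w <= 20 w. *)
have := cvx 1; have := cvx (- 1); rewrite normrN normr1 lexx.
move=> /(_ isT) c1 /(_ isT) c2.
by rewrite ler_norml; apply/andP; lra.
Qed.

(** * The endpoint x = 1 and the passage to the limit *)

Lemma lupas1 (R : realType) (q : R) n (f : R -> R) : 0 < q -> (0 < n)%N ->
  lupas n q f 1 = f 1.
Proof.
case: n => // n q0 _; rewrite /lupas big_nat_recr//= big_nat_cond big1 ?add0r; last first.
  move=> k /andP[/andP[_ kn] _].
  by rewrite subrr expr0n subn_eq0 leqNgt kn/= !(mulr0, mul0r).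
rewrite subnn expr0 mulr1 expr1n mulr1 divff ?gt_eqF ?qint_gt0//.
rewrite /qbinom subnn qfact0 mulr1 divff ?gt_eqF ?qfact_gt0// mulr1.
(* At x = 1 only the term k = n of the sum survives, and the denominator is the product of the q^j,
   which cancels the triangular power. *)
rewrite (_ : \prod_(1 <= j < n.+1) _ = q ^+ ((n.+1 * n) %/ 2)).
  by rewrite divff ?mulr1// expf_neq0// gt_eqF.
elim: n => [|n IH]; first by rewrite big_geq.
by rewrite big_nat_recr//= IH (triangleS n.+1) exprD subrr add0r mulr1.
Qed.

Theorem theorem19 (R : realType) :
  exists K : R, 0 < K /\
    forall (q : R) (f f1 f2 : R -> R) (n : nat) (x : R),
      0 < q < 1 -> C2_on01 f f1 f2 -> (1 <= n)%N -> 0 <= x <= 1 ->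
      `| qint q n / q ^+ n * (lupas n q f x - lupas_inf q f x)
         - f2 x / 2 * x * (1 - vq q x) |
      <= K * x * (1 - vq q x) * modulus f2 (qint q n `^ (- 2^-1)).
Proof.
exists 20; split => // q f f1 f2 n x q01 C2 n0 /andP[x0 x1].
have /andP[q0 q1] := q01.
(* The substitution u = x / (1 - x) excludes x = 1; there v = 1, both operators give f 1, and both
   sides vanish. *)
have [->|xN1] := eqVneq x 1.
  rewrite lupas1// /lupas_inf eqxx /vq !mulr1 !subrr add0r divff ?gt_eqF//.
  by rewrite !subrr !(mulr0, mul0r) subrr normr0.
have {xN1}x1 : x < 1 by rewrite lt_neqAle xN1.
have y0 : 1 - x != 0 by rewrite subr_eq0 gt_eqF.
have x01 : 0 <= x < 1 by rewrite x0.
pose u := x / (1 - x).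
have u0 : 0 <= u by rewrite divr_ge0// subr_ge0 ltW.
have z0 : 1 - x + q * x != 0 by rewrite gt_eqF// ltr_pwDl ?subr_gt0// mulr_ge0// ltW.
have xE : lp u = x by rewrite /lp /u; field; rewrite y0 subrK oner_neq0.
have vE : lp (q * u) = vq q x by rewrite /lp /vq /u; field; rewrite y0 z0.
have N0 : 0 < qint q n by case: (n) n0 => // k _; exact: qint_gt0.
have cf : {within `[0, 1], continuous f}.
  by case: C2 => /deriv_on01_continuous.
set w := modulus _ _.
pose D (m : nat) := x * (1 - vq q x) * ((qint q n)^-1 - (qint q m)^-1).
(* The limit of [D m], as 1/[m] tends to 1 - q. *)
pose Dl := x * (1 - vq q x) * ((qint q n)^-1 - (1 - q)).
have DD : D m @[m --> \oo] --> Dl.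
  apply: cvgMl_tmp; apply: cvgB; first exact: cvg_cst.
  rewrite -[1 - q]invrK; apply: cvgV; last exact: qint_cvg.
  by rewrite invr_eq0 subr_eq0 gt_eqF.
have lim_le : `|lupas n q f x - lupas_inf q f x - f2 x / 2 * Dl| <= 20 * w * Dl.
  apply: (ler_cvg_to (a := \oo)
    (f := fun m => `|lupas n q f x -
      lmean q m u (fun k => f (qint q k / qint q m)) - f2 x / 2 * D m|)
    (g := fun m => 20 * w * D m)).
  - apply: cvg_norm; apply: cvgB; last exact: cvgMl_tmp.
    by apply: cvgB; [exact: cvg_cst|exact: lmean_cvg].
  - exact: cvgMl_tmp.
  - near=> m; rewrite lupasE//.
    have nm : (0 < n <= m)%N by rewrite n0; near: m; exact: nbhs_infty_ge.
    have := lmean_voronovskaja C2 q01 u0 nm erefl.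
    by rewrite xE vE.
have P0 : 0 < qint q n / q ^+ n by rewrite divr_gt0// exprn_gt0.
(* 1/[n] - (1 - q) = q^n/[n], which the scaling factor of the theorem cancels exactly. *)
have PD : qint q n / q ^+ n * Dl = x * (1 - vq q x).
  have h : 1 - (1 - q) * qint q n = q ^+ n by rewrite qint_mulB1; ring.
  rewrite /Dl (_ : _ - (1 - q) = (1 - (1 - q) * qint q n) / qint q n).
    by rewrite h; field; rewrite expf_neq0 ?gt_eqF.
  by field; rewrite gt_eqF.
have := ler_wpM2l (ltW P0) lim_le.
rewrite -[X in X * `|_|](gtr0_norm P0) -normrM mulrBr.
rewrite (_ : _ * (f2 x / 2 * Dl) = f2 x / 2 * x * (1 - vq q x)); last first.
  by rewrite -[RHS]mulrA -PD; ring.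
rewrite (_ : _ * (20 * w * Dl) = 20 * x * (1 - vq q x) * w)//.
by rewrite -[20 * x * _]mulrA -PD; ring.
Unshelve. all: by end_near. Qed.
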